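(* Let $G$ be a DAG on the vertex set $[m]=\{1,\ldots,m\}$ and let $\sigma$ be any topological ordering of $G$. Then $$\mathbb{M}_+(G)=\mathbb{M}(G)\cap \mathrm{CIS}_\sigma .$$
   Context: All Gaussian distributions considered have positive definite covariance matrix. $\mathbb{M}(G)$ is the set of Gaussian distributions of vectors $X=(X_1,\ldots,X_m)$ admitting a representation $X_i=\sum_{j\in \mathrm{Pa}(i)}\Lambda_{ij}X_j+\varepsilon_i$ for all $i=1,\ldots,m$, where $\mathrm{Pa}(i)$ is the set of parents of $i$ in $G$, $\Lambda_{ij}\in\mathbb{R}$, and $\varepsilon_i\sim N(0,\sigma_i^2)$ are mutually independent. $\mathbb{M}_+(G)\subseteq \mathbb{M}(G)$ is the subset of those distributions for which such a representation exists with all $\Lambda_{ij}\ge 0$. A permutation $\sigma$ of $[m]$ is a topological ordering of $G$ if the list $\sigma(1),\sigma(2),\ldots,\sigma(m)$ has every parent before its children, i.e. $a\to b$ in $G$ implies $\sigma^{-1}(a)<\sigma^{-1}(b)$. A random vector $Y=(Y_1,\ldots,Y_m)$ is conditionally increasing in sequence (CIS) if for every $i\in[m]$ and every fixed $y_i\in\mathbb{R}$, the function $(y_1,\ldots,y_{i-1})\mapsto \mathbb{P}(Y_i\ge y_i\mid Y_j=y_j \text{ for all } j<i)$ is non-decreasing in each coordinate (using the usual, continuous, Gaussian conditional distribution in the Gaussian case). $\mathrm{CIS}_\sigma$ is the set of all Gaussian distributions of $X$ such that $(X_{\sigma(1)},\ldots,X_{\sigma(m)})$ is CIS. *)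

(* Defs.v *)
(* A law on R^m is a probability measure on m.-tuple R with its product
   sigma-algebra.  Measures here are functions on all sets, so laws are only ever
   compared on measurable sets. *)
From HB Require Import structures.
From mathcomp Require Import all_boot all_order all_algebra all_fingroup.
From mathcomp Require Import all_classical all_reals all_analysis.
Import Order.TTheory GRing.Theory Num.Theory numFieldNormedType.Exports.

Set Implicit Arguments.
Unset Strict Implicit.
Unset Printing Implicit Defensive.

Local Open Scope classical_set_scope.
Local Open Scope ring_scope.

(* G a b is read as the edge a -> b; loops are excluded since connect is reflexive. *)
Definition acyclic (m : nat) (G : rel 'I_m) : Prop :=
  forall a b : 'I_m, G a b -> ~~ connect G b a.

Definition topological_ordering (m : nat) (G : rel 'I_m) (sigma : {perm 'I_m}) : Prop :=
  forall a b : 'I_m, G a b -> ((sigma^-1)%g a < (sigma^-1)%g b)%N.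

(* The univariate N(a, s^2).  The library's normal_prob a 0 is the uniform law on
   [0, 1], hence the separate case s = 0, where N(a, 0) is the point mass at a. *)
Definition gauss1 (R : realType) (a s : R) : set R -> \bar R :=
  if s == 0 then \d_a else normal_prob a s.

Definition has_gauss1 (R : realType) d (T : measurableType d) (Q : probability T R)
    (Y : T -> R) (a s : R) : Prop :=
  forall B : set R, measurable B -> Q (Y @^-1` B) = gauss1 a s B.

Definition coordinate (R : realType) (m : nat) (i : 'I_m) (x : m.-tuple R) : R :=
  tnth x i.

Definition covariance_mx (R : realType) (m : nat)
    (P : probability (m.-tuple R) R) : 'M[R]_m :=
  \matrix_(i, j) fine (covariance P (@coordinate R m i) (@coordinate R m j)).

(* Multivariate Gaussian (every linear combination of the coordinates is
   univariate Gaussian) with positive definite covariance matrix. *)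
Definition gaussian (R : realType) (m : nat) (P : probability (m.-tuple R) R) : Prop :=
  (forall u : 'rV[R]_m, exists a s : R,
     has_gauss1 P (fun x => \sum_i u 0 i * coordinate i x) a s) /\
  (forall u : 'rV[R]_m, u != 0 -> 0 < (u *m covariance_mx P *m u^T) 0 0).

Definition mutually_independent (R : realType) d (T : measurableType d)
    (Q : probability T R) (I : finType) (X : I -> {RV Q >-> R}) : Prop :=
  forall (J : {set I}) (B : I -> set R), (forall i, measurable (B i)) ->
    Q (\bigcap_(i in [set` J]) (X i @^-1` B i)) =
    (\prod_(i in J) Q (X i @^-1` B i))%E.

(* P is the law of a vector X, on some probability space, satisfying
   X_i = sum_(j in Pa(i)) L_ij X_j + eps_i with independent eps_i ~ N(0, s_i^2).
   s_i = 0 is not excluded here; positive definiteness rules it out below. *)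
Definition has_representation (R : realType) (m : nat) (G : rel 'I_m)
    (L : 'M[R]_m) (P : probability (m.-tuple R) R) : Prop :=
  exists (d : measure_display) (T : measurableType d) (Q : probability T R)
         (X eps : 'I_m -> {RV Q >-> R}) (s : 'I_m -> R),
    [/\ forall A : set (m.-tuple R), measurable A ->
          Q ((fun w => [tuple X i w | i < m]) @^-1` A) = P A,
        mutually_independent eps,
        forall i, has_gauss1 Q (eps i) 0 (s i) &
        forall i w, X i w = \sum_(j | G j i) L i j * X j w + eps i w].

Definition MM (R : realType) (m : nat) (G : rel 'I_m) :
    set (probability (m.-tuple R) R) :=
  [set P | gaussian P /\ exists L : 'M[R]_m, has_representation G L P].

Definition MM_plus (R : realType) (m : nat) (G : rel 'I_m) :
    set (probability (m.-tuple R) R) :=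
  [set P | gaussian P /\ exists L : 'M[R]_m,
     (forall i j, G j i -> 0 <= L i j) /\ has_representation G L P].

Definition row_of_tuple (R : realType) (n : nat) (t : n.-tuple R) : 'rV[R]_n :=
  \row_j tnth t j.

(* g is a version of the conditional probability z |-> Q(E | Z = z). *)
Definition is_cond_prob (R : realType) d (T : measurableType d) (Q : probability T R)
    (n : nat) (Z : T -> n.-tuple R) (E : set T) (g : 'rV[R]_n -> R) : Prop :=
  measurable_fun setT (fun t : n.-tuple R => g (row_of_tuple t)) /\
  forall A : set (n.-tuple R), measurable A ->
    Q (Z @^-1` A `&` E) = (\int[Q]_(w in Z @^-1` A) (g (row_of_tuple (Z w)))%:E)%E.

Definition nondecreasing_coordinatewise (R : realType) (n : nat) (g : 'rV[R]_n -> R) : Prop :=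
  forall (j : 'I_n) (y y' : 'rV[R]_n),
    (forall k, k != j -> y 0 k = y' 0 k) -> y 0 j <= y' 0 j -> g y <= g y'.

Definition predecessors (R : realType) (T : Type) (m : nat) (Y : 'I_m -> T -> R)
    (i : 'I_m) (w : T) : i.-tuple R :=
  [tuple Y (widen_ord (ltnW (ltn_ord i)) j) w | j < i].

(* Conditional probabilities are only determined up to null sets; g is the
   continuous version.  When Y is Gaussian with positive definite covariance this
   version exists and, the law of the predecessors having full support, is unique. *)
Definition CIS (R : realType) d (T : measurableType d) (Q : probability T R)
    (m : nat) (Y : 'I_m -> T -> R) : Prop :=
  forall (i : 'I_m) (t : R), exists g : 'rV[R]_i -> R,
    [/\ continuous g,
        is_cond_prob Q (predecessors Y i) [set w | t <= Y i w] g &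
        nondecreasing_coordinatewise g].

Definition CIS_ordered (R : realType) (m : nat) (sigma : {perm 'I_m}) :
    set (probability (m.-tuple R) R) :=
  [set P | gaussian P /\ CIS P (fun i => @coordinate R m (sigma i))].

(* Main.v *)
From HB Require Import structures.
Require Import Defs.
From mathcomp Require Import all_boot all_order all_algebra all_fingroup.
From mathcomp Require Import all_classical all_reals all_analysis.
From mathcomp Require Import measurable_realfun lra ring.
Import Order.TTheory GRing.Theory Num.Theory numFieldNormedType.Exports.

Set Implicit Arguments.
Unset Strict Implicit.
Unset Printing Implicit Defensive.

Local Open Scope classical_set_scope.
Local Open Scope ring_scope.

(** Fix a representation of a Gaussian law P with coefficients L, and list the
    vertices in the order sigma.  Writing Y_k for the coordinate sigma(k), the
    structural equations become Y_k = sum_(j < k) l_kj Y_j + E_k, with independent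
    centred normal E_k.  Two facts about this system carry the proof.

    - The past (Y_j)_(j < k) is a function of (E_j)_(j < k) (triangular_inverse),
      hence independent of E_k.  Positive definiteness forces E_k to have a nonzero
      variance s_k^2 (gaussian_nondegenerate), so
        y |-> normal_tail s_k (t - sum_(j < k) l_kj y_j)
      is a continuous version of P(Y_k >= t | past = y) (normal_cond_probP).

    - Y has full support (full_support), so this continuous version is the only
      one (cond_prob_unique).

    The normal tail is strictly decreasing, so the conditional probability is
    monotone in every y_j if and only if l_kj >= 0 for all j < k.  Thus the law is
    CIS along sigma if and only if the coefficients on the edges of G are
    nonnegative (representation_CIS_iff), and this holds for any given
    representation: both inclusions of the theorem keep the same L. *)

(** * The univariate normal law *)

Section NormalLaw.
Context {R : realType}.
Implicit Types a b c s x : R.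
Local Notation mu := (@lebesgue_measure R).

Lemma normal_pdf_gt0 a s x : s != 0 -> 0 < normal_pdf a s x.
Proof.
by move=> s0; rewrite normal_pdfE// mulr_gt0 ?normal_peak_gt0 ?expR_gt0.
Qed.

(** The density is positive everywhere, so it could have integral zero over an
    interval only if the interval were Lebesgue-null. *)
Lemma normal_prob_ooitv_gt0 a s b c : s != 0 -> b < c ->
  (0 < normal_prob a s `]b, c[)%E.
Proof.
move=> s0 bc; rewrite lt0e measure_ge0 andbT; apply/eqP => N0.
have mf : measurable_fun `]b, c[ (EFin \o normal_pdf a s).
  by apply/measurable_funTS/measurable_EFinP; exact: measurable_normal_pdf.
have : ae_eq mu `]b, c[%classic (EFin \o normal_pdf a s) (cst 0%E).
  apply/ae_eq_integral_abs => //; rewrite -[RHS]N0.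
  by apply: eq_integral => x _; rewrite gee0_abs// lee_fin normal_pdf_ge0.
move=> [N [mN N0' subN]].
have : (mu `]b, c[ <= mu N)%E.
  apply: le_measure; rewrite ?inE//= => x xbc; apply: subN => /= /(_ xbc).
  by case; apply/eqP; rewrite gt_eqF// normal_pdf_gt0.
by rewrite N0' lebesgue_measure_itv/= lte_fin bc -EFinD lee_fin leNgt subr_gt0 bc.
Qed.

Lemma normal_prob_coitv_le a s b c : s != 0 -> b <= c ->
  (normal_prob a s `[b, c[ <= (normal_peak s * (c - b))%:E)%E.
Proof.
move=> s0 bc.
have [->|cb] := eqVneq b c; first by rewrite set_itvco0 measure0 subrr mulr0.
have {}bc : b < c by rewrite lt_neqAle cb.
apply: (@le_trans _ _ (\int[mu]_(x in `[b, c[) (normal_peak s)%:E)%E).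
  apply: ge0_le_integral => //=.
  - by move=> x _; rewrite lee_fin normal_pdf_ge0.
  - by apply/measurable_funTS/measurable_EFinP; exact: measurable_normal_pdf.
  - by move=> x _; rewrite lee_fin normal_pdf_ub.
rewrite integral_cst//= lebesgue_measure_itv/= lte_fin bc -EFinD.
by rewrite -EFinM lee_fin.
Qed.

(** The survival function of the centred normal law; conditional probabilities
    P(Y_i >= t | Y_j, j < i) are its values at affine functions of the past. *)
Definition normal_tail s c : R := fine (normal_prob 0 s `[c, +oo[).

Lemma normal_tailE s c : normal_prob 0 s `[c, +oo[ = (normal_tail s c)%:E.
Proof. by rewrite fineK// fin_num_measure. Qed.

Lemma normal_tail_ge0 s c : 0 <= normal_tail s c.
Proof. by rewrite fine_ge0// measure_ge0. Qed.

Lemma normal_tail_split s b c : b <= c ->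
  (normal_tail s b)%:E = (normal_prob 0 s `[b, c[ + (normal_tail s c)%:E)%E.
Proof.
move=> bc; rewrite -!normal_tailE -measureU//.
  by rewrite -itv_bndbnd_setU// bnd_simp.
apply/seteqP; split => x //=; rewrite !in_itv/= !andbT.
by move=> [/andP[_ xc] /(lt_le_trans xc)]; rewrite ltxx.
Qed.

(** Strictness is what makes the sign of a regression coefficient visible in the
    conditional probability. *)
Lemma normal_tail_decr s b c : s != 0 -> b < c -> normal_tail s c < normal_tail s b.
Proof.
move=> s0 bc; rewrite -lte_fin (normal_tail_split _ (ltW bc)).
rewrite -[X in (X < _)%E]add0e lteD2rE//.
apply: lt_le_trans (normal_prob_ooitv_gt0 0 s0 bc) _.
by apply: le_measure; rewrite ?inE//=; apply: subset_itvr; rewrite bnd_simp.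
Qed.

(** The density is bounded by its peak. *)
Lemma normal_tail_lipschitz s b c : s != 0 ->
  `|normal_tail s b - normal_tail s c| <= normal_peak s * `|b - c|.
Proof.
move=> s0; wlog bc : b c / b <= c.
  move=> h; have [|/ltW] := leP b c; first exact: h.
  by rewrite distrC [`|b - c|]distrC; apply: h.
rewrite [`|b - c|]distrC (ger0_norm (_ : 0 <= c - b)) ?subr_ge0//.
have := normal_prob_coitv_le 0 s0 bc.
have := normal_tail_split s bc.
have : (0 <= normal_prob 0 s `[b, c[)%E by exact: measure_ge0.
case: (normal_prob 0 s `[b, c[)%E => // p; rewrite -EFinD !lee_fin => p0 [->] ?.
by rewrite addrK ger0_norm.
Qed.

Lemma continuous_normal_tail s : s != 0 -> continuous (normal_tail s).
Proof.
move=> s0 b; apply/cvgrPdist_lt => e e0.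
have p0 := normal_peak_gt0 s0.
near=> c; apply: le_lt_trans (normal_tail_lipschitz _ _ s0) _.
rewrite mulrC -ltr_pdivlMr//; near: c.
by apply: cvgr_dist_lt; [exact: cvg_id|rewrite divr_gt0].
Unshelve. all: by end_near. Qed.

Local Open Scope ereal_scope.

(** Change of density: the Radon-Nikodym derivative of the normal law agrees
    almost everywhere with the explicit density. *)
Lemma ge0_integral_normal_prob a s (f : R -> \bar R) :
  measurable_fun setT f -> (forall x, 0 <= f x) ->
  \int[normal_prob a s]_x f x = \int[mu]_x (f x * (normal_pdf a s x)%:E).
Proof.
move=> mf f0; have dom := normal_prob_dominates a s.
rewrite -(Radon_Nikodym_SigmaFinite.change_of_variables dom)//.
have mrn := Radon_Nikodym_SigmaFinite.f_integrable dom.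
have mp : measurable_fun setT (EFin \o normal_pdf a s).
  by apply/measurable_EFinP; exact: measurable_normal_pdf.
apply: ae_eq_integral => //.
- by apply: emeasurable_funM => //; exact: (measurable_int mu).
- exact: emeasurable_funM.
- apply: ae_eqe_mul2l => /=; apply: integral_ae_eq => //= E _ mE.
  by rewrite -Radon_Nikodym_SigmaFinite.f_integral.
Qed.

(** Half of the Gaussian exponent absorbs the square, since
    z^2 / (4 s^2) <= exp (z^2 / (4 s^2)); what is left is the density of standard
    deviation s * sqrt 2, up to a constant. *)
Lemma sqr_normal_pdf_le a s x : s != 0%R ->
  ((x - a) ^+ 2 * normal_pdf a s x <=
  s ^+ 2 *+ 4 * normal_peak s / normal_peak (s * Num.sqrt 2)
    * normal_pdf a (s * Num.sqrt 2) x)%R.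
Proof.
move=> s0.
have r0 : (s * Num.sqrt 2 != 0 :> R)%R by rewrite mulf_neq0// sqrtr_eq0 -ltNge.
rewrite !normal_pdfE// -mulrA.
set p' := normal_peak (_ * _).
have p'0 : (p' != 0)%R by rewrite gt_eqF// normal_peak_gt0.
rewrite [X in (_ <= _ * X)%R]mulrA mulVf// mul1r.
rewrite mulrCA [leRHS]mulrAC [leRHS]mulrC ler_pM2l ?normal_peak_gt0//.
rewrite /normal_fun exprMn sqr_sqrtr ?ler0n//.
set z := ((x - a) ^+ 2)%R.
have s20 : (0 < s ^+ 2)%R by rewrite exprn_even_gt0.
have -> : (- z / (s ^+ 2 *+ 2) = - z / (s ^+ 2 * 2 *+ 2) + - (z / (s ^+ 2 *+ 4)))%R.
  rewrite -[(s ^+ 2 * 2 *+ 2)%R]mulr_natr -[(s ^+ 2 *+ 2)%R]mulr_natr.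
  by rewrite -[(s ^+ 2 *+ 4)%R]mulr_natr; field.
rewrite expRD mulrCA mulrC ler_pM2r ?expR_gt0// expRN.
rewrite ler_pdivrMr ?expR_gt0//.
have := expR_ge1Dx (z / (s ^+ 2 *+ 4)).
set e := expR _ => h.
have {h} : (z / (s ^+ 2 *+ 4) <= e)%R by rewrite (le_trans _ h)// lerDr.
by rewrite ler_pdivrMr ?mulrn_wgt0// mulrC.
Qed.

Lemma normal_prob_second_moment a s : s != 0%R ->
  \int[normal_prob a s]_x ((x - a) ^+ 2)%:E < +oo.
Proof.
move=> s0; rewrite ge0_integral_normal_prob; last 2 first.
- by apply/measurable_EFinP; apply: measurable_funX; exact: measurable_funB.
- by move=> x; rewrite lee_fin sqr_ge0.
set C : R := (s ^+ 2 *+ 4 * normal_peak s / normal_peak (s * Num.sqrt 2))%R.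
apply: (@le_lt_trans _ _ (\int[mu]_x (C%:E * (normal_pdf a (s * Num.sqrt 2) x)%:E))).
  apply: ge0_le_integral => //.
  - by move=> x _; rewrite mule_ge0// lee_fin ?sqr_ge0 ?normal_pdf_ge0.
  - apply: emeasurable_funM; apply/measurable_EFinP.
      by apply: measurable_funX; exact: measurable_funB.
    exact: measurable_normal_pdf.
  - apply: emeasurable_funM => //.
    by apply/measurable_EFinP; exact: measurable_normal_pdf.
  - by move=> x _; rewrite -!EFinM lee_fin sqr_normal_pdf_le.
rewrite ge0_integralZl//.
- by rewrite integral_normal_pdf mule1 ltry.
- by apply/measurable_EFinP; exact: measurable_normal_pdf.
- by move=> x _; rewrite lee_fin normal_pdf_ge0.
- rewrite lee_fin divr_ge0 ?normal_peak_ge0// mulr_ge0 ?normal_peak_ge0//.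
  by rewrite mulrn_wge0 ?sqr_ge0.
Qed.

End NormalLaw.

(** * Square-integrability and nondegeneracy of Gaussian vectors *)

Lemma measurable_preimageT d d' (T : measurableType d) (T' : measurableType d')
    (f : T -> T') (B : set T') :
  measurable_fun setT f -> measurable B -> measurable (f @^-1` B).
Proof. by move=> mf mB; rewrite -[X in measurable X]setTI; exact: mf. Qed.

Section SquareIntegrability.
Context d (T : measurableType d) (R : realType) (Q : probability T R).

Lemma Lfun2_sqr (f : T -> R) : measurable_fun setT f ->
  (\int[Q]_w ((f w) ^+ 2)%:E < +oo)%E -> f \in Lfun Q 2%:E.
Proof.
move=> mf h; rewrite inE; apply/andP; split; first by rewrite inE.
rewrite inE/= /finite_norm unlock /Lnorm poweR_lty//.
by under eq_integral => x _ do rewrite /= powR_mulrn// -normrX ger0_norm ?sqr_ge0//.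
Qed.

Lemma Lfun2D (f g : T -> R) : f \in Lfun Q 2%:E -> g \in Lfun Q 2%:E ->
  f \+ g \in Lfun Q 2%:E.
Proof.
have le12 : (1 <= 2%:E :> \bar R)%E by rewrite lee_fin ler1n.
by have [_] := Lfun_addr_closed Q le12; apply.
Qed.

Lemma has_gauss1_Lfun2 (Y : T -> R) (a s : R) : measurable_fun setT Y ->
  has_gauss1 Q Y a s -> Y \in Lfun Q 2%:E.
Proof.
move=> mY hY.
have -> : Y = (Y \- cst a) \+ cst a by apply/funext => w; rewrite !fctE/= subrK.
apply: Lfun2D; last exact: Lfun_cst.
have mYa : measurable_fun setT (Y \- cst a) by exact: measurable_funB.
apply: Lfun2_sqr => //.
pose f (y : measurableTypeR R) := ((y - a) ^+ 2)%:E.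
have mf : measurable_fun setT f.
  by apply/measurable_EFinP; apply: measurable_funX; exact: measurable_funB.
have f0 y : (0 <= f y)%E by rewrite lee_fin sqr_ge0.
(* The normal law is a measure on the g_sigma_algebraType copy of the reals,
   which carries another display; hence the recast of Y. *)
pose Y' : T -> measurableTypeR R := Y.
have mY' : measurable_fun setT Y' by [].
have -> : (\int[Q]_w ((Y \- cst a) w ^+ 2)%:E = \int[pushforward Q Y']_y f y)%E.
  by rewrite ge0_integral_pushforward.
have [s0|s0] := eqVneq s 0.
  rewrite (eq_measure_integral (@dirac _ (measurableTypeR R) a R)); last first.
    by move=> A mA _; have := hY A mA; rewrite /gauss1 s0 eqxx.
  by rewrite integral_dirac// diracT mul1e ltry.
rewrite (eq_measure_integral (normal_prob a s)); last first.
  by move=> A mA _; have := hY A mA; rewrite /gauss1 (negbTE s0).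
exact: normal_prob_second_moment.
Qed.

Lemma covariance_ae0 (X V : T -> R) : X \in Lfun Q 2%:E -> measurable_fun setT V ->
  Q (V @^-1` [set 0]) = 1%E -> covariance Q X V = 0%E.
Proof.
move=> X2 mV V0.
have mX : measurable_fun setT X by move: X2; rewrite inE => /andP[/[!inE]].
have V_ae : ae_eq Q setT (EFin \o V) (cst 0%E).
  have mV0 : measurable (V @^-1` [set 0]) by exact: measurable_preimageT.
  exists (~` (V @^-1` [set 0])); split.
  - exact: measurableC.
  - by have := probability_setC Q mV0; rewrite V0 subee.
  - by move=> w /= h Vw; apply: h; rewrite Vw.
have EV : ('E_Q[V] = 0)%E.
  rewrite unlock (ae_eq_integral (cst 0%E))//; last exact/measurable_EFinP.
  by rewrite integral0.
rewrite unlock EV unlock (ae_eq_integral (cst 0%E))//.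
- by rewrite integral0.
- apply/measurable_EFinP; apply: measurable_funM; apply: measurable_funB => //.
- case: V_ae => N [mN N0 sub]; exists N; split => // w /= h; apply: sub => /= h'.
  by apply: h => _; move: (h' I) => [Vw0]; rewrite !fctE/= Vw0 subrr mulr0.
Qed.

End SquareIntegrability.

Section Nondegeneracy.
Context (R : realType) (m : nat) (P : probability (m.-tuple R) R).
Hypothesis gP : gaussian P.

Lemma measurable_coordinate i : measurable_fun setT (@coordinate R m i).
Proof. exact: measurable_tnth. Qed.

Lemma coordinate_Lfun2 i : @coordinate R m i \in Lfun P 2%:E.
Proof.
have [a [s h]] := gP.1 (delta_mx 0 i).
apply: (has_gauss1_Lfun2 (a := a) (s := s)); first exact: measurable_coordinate.
suff -> : coordinate i =
  (fun x : m.-tuple R => \sum_j (delta_mx 0 i : 'rV[R]_m) 0 j * coordinate j x) by [].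
apply/funext => x; rewrite (bigD1 i)//= big1 ?addr0 => [|j ji].
  by rewrite mxE !eqxx mul1r.
by rewrite mxE (negbTE ji) andbF mul0r.
Qed.

(** The entries of the covariance matrix are finite parts of extended real
    integrals, so bilinearity of the covariance is available only because the
    coordinates are square-integrable. *)
Lemma covariance_sumr (u : 'rV[R]_m) j (r : seq 'I_m) :
  (fun x => \sum_(k <- r) u 0 k * coordinate k x) \in Lfun P 2%:E /\
  covariance P (coordinate j) (fun x => \sum_(k <- r) u 0 k * coordinate k x) =
  (\sum_(k <- r) u 0 k * covariance_mx P j k)%:E.
Proof.
have Pfin : P setT \is a fin_num := fin_num_measure P _ measurableT.
elim: r => [|k r [L2 IH]].
  rewrite (_ : (fun x => _) = cst 0); last by apply/funext => x; rewrite big_nil.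
  by rewrite big_nil covariance_cst_r; split => //; apply: Lfun_cst.
rewrite (_ : (fun x => _) = (u 0 k \o* coordinate k) \+
    (fun x => \sum_(k <- r) u 0 k * coordinate k x)); last first.
  by apply/funext => x; rewrite big_cons/= mulrC.
have Lk : u 0 k \o* coordinate k \in Lfun P 2%:E.
  by apply: Lfun_scale; [rewrite ler1n|exact: coordinate_Lfun2].
split; first exact: Lfun2D.
rewrite covarianceDr //; last exact: coordinate_Lfun2.
have L1 i := Lfun_subset12 Pfin (coordinate_Lfun2 i).
have L11 := Lfun2_mul_Lfun1 (coordinate_Lfun2 j) (coordinate_Lfun2 k).
rewrite IH covarianceZr// big_cons EFinD EFinM; congr (_ * _ + _)%E.
by rewrite mxE fineK// covariance_fin_num.
Qed.

(** A linear form that vanishes almost surely has covariance zero with every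
    coordinate, hence zero variance, which contradicts positive definiteness. *)
Lemma gaussian_nondegenerate (u : 'rV[R]_m) : u != 0 ->
  P ((fun x => \sum_k u 0 k * coordinate k x) @^-1` [set 0]) != 1%E.
Proof.
move=> u0; apply/eqP => h.
have := gP.2 u u0; suff -> : (u *m covariance_mx P *m u^T) 0 0 = 0 by rewrite ltxx.
rewrite -mulmxA mxE big1// => j _; rewrite mxE.
have [_] := covariance_sumr u j (index_enum _).
rewrite covariance_ae0//.
- move=> [h0]; rewrite (eq_bigr (fun k => u 0 k * covariance_mx P j k)).
    by rewrite -h0 mulr0.
  by move=> k _; rewrite [u^T _ _]mxE mulrC.
- exact: coordinate_Lfun2.
- apply: measurable_sum => k; apply: measurable_funM => //.
  exact: measurable_coordinate.
Qed.

End Nondegeneracy.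

(** * Independence of the past and the present noise *)

Section TupleLaw.
Context {R : realType}.

Lemma measurable_box n (C : 'I_n -> set R) : (forall j, measurable (C j)) ->
  measurable [set t : n.-tuple R | forall j, C j (tnth t j)].
Proof.
move=> mC.
rewrite (_ : [set _ | _] = \bigcap_(j in [set: 'I_n]) ((fun t => tnth t j) @^-1` C j)).
  apply: fin_bigcap_measurable => // j _.
  by apply: measurable_preimageT => //; exact: measurable_tnth.
by apply/seteqP; split=> [t h j _|t h j]; apply: h.
Qed.

(** Boxes form a pi-system that generates the product sigma-algebra. *)
Lemma measure_tuple_unique n (m1 m2 : {measure set (n.-tuple R) -> \bar R}) :
  (m1 setT < +oo)%E ->
  (forall C : 'I_n -> set R, (forall j, measurable (C j)) ->
    m1 [set t | forall j, C j (tnth t j)] = m2 [set t | forall j, C j (tnth t j)]) ->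
  forall A, measurable A -> m1 A = m2 A.
Proof.
move=> m1T m12.
pose G : set (set (n.-tuple R)) := [set A | exists2 C : 'I_n -> set R,
  (forall j, measurable (C j)) & A = [set t | forall j, C j (tnth t j)]].
have GT : G setT by exists (fun=> setT) => //; apply/seteqP; split.
apply: (@measure_unique _ R _ G (fun=> setT)) => //.
- apply/seteqP; split; last first.
    apply: smallest_sub; first exact: sigma_algebra_measurable.
    by move=> _ [C mC ->]; exact: measurable_box.
  apply: smallest_sub; first exact: smallest_sigma_algebra.
  rewrite -bigcup_seq; apply: bigcup_sub => j _ _ [B mB <-].
  apply: sub_sigma_algebra; exists (fun k => if k == j then B else setT).
    by move=> k; case: ifP.
  rewrite setTI; apply/seteqP; split=> [t tB k|t /(_ j)]; last by rewrite eqxx.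
  by case: eqP => // ->.
- move=> _ _ [C mC ->] [D mD ->]; exists (fun j => C j `&` D j).
    by move=> j; exact: measurableI.
  apply/seteqP; split=> [t [tC tD] j|t tCD]; first by split.
  by split=> j; have [] := tCD j.
- by rewrite bigcup_const.
- by move=> _ [C mC ->]; exact: m12.
Qed.

End TupleLaw.

Section Independence.
Context d (T : measurableType d) (R : realType) (Q : probability T R).
Context (m : nat) (E : 'I_m -> T -> R).
Hypothesis mE : forall i, measurable_fun setT (E i).
Hypothesis indepE : forall (J : {set 'I_m}) (B : 'I_m -> set R),
  (forall i, measurable (B i)) ->
  Q (\bigcap_(i in [set` J]) (E i @^-1` B i)) = (\prod_(i in J) Q (E i @^-1` B i))%E.

Lemma measurable_predecessors (Y : 'I_m -> T -> R) (i : 'I_m) :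
  (forall j, measurable_fun setT (Y j)) -> measurable_fun setT (predecessors Y i).
Proof.
move=> mY; apply/measurable_fun_tnthP => j.
rewrite (_ : _ \o _ = Y (widen_ord (ltnW (ltn_ord i)) j)) //.
by apply/funext => w /=; rewrite tnth_mktuple.
Qed.

(** Independence is given on boxes only.  For fixed B both sides are finite
    measures in A, so agreement on boxes extends to all measurable A. *)
Lemma predecessors_independent (i : 'I_m) (A : set (i.-tuple R)) (B : set R) :
  measurable A -> measurable B ->
  Q (predecessors E i @^-1` A `&` E i @^-1` B) =
  (Q (predecessors E i @^-1` A) * Q (E i @^-1` B))%E.
Proof.
move=> + mB; move: A.
have mF : measurable_fun setT (predecessors E i) by exact: measurable_predecessors.
have mB' := measurable_preimageT (mE i) mB.
have q0 : (0 <= fine (Q (E i @^-1` B)))%R by rewrite fine_ge0.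
have qE : Q (E i @^-1` B) = (fine (Q (E i @^-1` B)))%:E by rewrite fineK ?fin_num_measure.
pose m1 : {measure set (i.-tuple R) -> \bar R} :=
  pushforward (mrestr Q mB') (predecessors E i).
pose m2 : {measure set (i.-tuple R) -> \bar R} :=
  mscale (NngNum q0) (pushforward Q (predecessors E i)).
suff h A : measurable A -> m1 mF A = m2 mF A.
  by move=> A /h; rewrite muleC [in X in _ -> X]qE.
apply: measure_tuple_unique => /=.
  rewrite /pushforward /mrestr preimage_setT setTI ltey_eq.
  by rewrite fin_num_measure.
move=> C mC; rewrite /mscale/= -qE /pushforward /mrestr.
(* Extends the sides C of the box, at the indices below i, by the side B at i. *)
pose B_ (k : 'I_m) := if (insub (k : nat) : option 'I_i) is Some j then C j else B.
have mB_ k : measurable (B_ k) by rewrite /B_; case: insub.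
have B_lt (j : 'I_i) : B_ (widen_ord (ltnW (ltn_ord i)) j) = C j.
  by rewrite /B_; case: insubP => [j' _ /= jj'|/negP[]//=]; congr C; apply/val_inj.
have B_i : B_ i = B by rewrite /B_; case: insubP => //= j; rewrite ltnn.
pose J := [set k : 'I_m | (k < i)%N]%SET; pose K := (i |: J)%SET.
have -> : predecessors E i @^-1` [set t | forall j, C j (tnth t j)] =
    \bigcap_(k in [set` J]) (E k @^-1` B_ k).
  apply/seteqP; split=> [w h k|w h j] /=.
    rewrite inE => ki; have := h (Ordinal ki); rewrite tnth_mktuple -B_lt.
    by congr (B_ _ (E _ w)); apply/val_inj.
  rewrite tnth_mktuple -B_lt; apply: h; rewrite /= inE /=; exact: ltn_ord.
have -> : \bigcap_(k in [set` J]) (E k @^-1` B_ k) `&` E i @^-1` B =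
    \bigcap_(k in [set` K]) (E k @^-1` B_ k).
  apply/seteqP; split=> [w [h hi] k|w h].
    by rewrite /= !inE => /orP[/eqP ->|ki]; [rewrite B_i|apply: h; rewrite /= inE].
  split; last by have := h i; rewrite B_i; apply; rewrite /= !inE eqxx.
  by move=> k; rewrite /= inE => ki; apply: h; rewrite /= !inE ki orbT.
rewrite !indepE// big_setU1 ?inE ?ltnn//=.
by rewrite B_i.
Qed.

End Independence.

(** * Uniqueness of continuous conditional probabilities *)

Section CondProbUnique.
Context d (T : measurableType d) (R : realType) (Q : probability T R).
Context (n : nat) (Z : T -> n.-tuple R) (E : set T).
Hypothesis mZ : measurable_fun setT Z.
Hypothesis supp : forall (z : 'rV[R]_n) (r : R), 0 < r ->
  (0 < Q [set w | forall j, (`|z 0%R j - tnth (Z w) j| < r)%R])%E.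

(** If g z < h z, then g and h are separated by a constant on a small box around
    z.  The box has positive mass under Z, so integrating over it gives different
    values, although both integrals are the probability of the same event. *)
Lemma cond_prob_not_lt (g h : 'rV[R]_n -> R) (z : 'rV[R]_n) :
  continuous g -> is_cond_prob Q Z E g -> continuous h -> is_cond_prob Q Z E h ->
  h z <= g z.
Proof.
move=> cg [mg Qg] ch [mh Qh]; rewrite leNgt; apply/negP => gh.
(* With thirds, g < g z + e < h z - e < h near z. *)
pose e := (h z - g z) / 3.
have e0 : 0 < e by rewrite divr_gt0 ?subr_gt0.
have : \forall y \near z, `|g z - g y| < e /\ `|h z - h y| < e.
  near=> y; split; near: y.
    by apply: cvgr_dist_lt => //; exact: cg.
  by apply: cvgr_dist_lt => //; exact: ch.
move=> /nbhs_ballP[r /= r0 rB].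
pose U := [set t : n.-tuple R | forall j, `|z 0 j - tnth t j| < r].
have mU : measurable U.
  apply: (measurable_box (C := fun j => [set x : R | `|z 0 j - x| < r])) => j.
  rewrite (_ : [set _ | _] = ball (z 0 j) r)//; exact: measurable_ball.
have UB t : U t -> `|g z - g (row_of_tuple t)| < e /\ `|h z - h (row_of_tuple t)| < e.
  move=> Ut; apply: rB; split=> // i j; rewrite ord1 mxE; exact: Ut.
have mZU : measurable (Z @^-1` U) by exact: measurable_preimageT.
have QU0 : (0 < Q (Z @^-1` U))%E by exact: supp.
have Qfin : (Q (Z @^-1` U) < +oo)%E by rewrite ltey_eq fin_num_measure.
have intf (f : 'rV[R]_n -> R) :
    measurable_fun setT (fun t : n.-tuple R => f (row_of_tuple t)) ->
    (forall t, U t -> `|f z - f (row_of_tuple t)| < e) ->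
    Q.-integrable (Z @^-1` U) (EFin \o (fun w => f (row_of_tuple (Z w)))).
  move=> mf fB; apply: measurable_bounded_integrable => //.
    by apply: measurable_funTS; exact: (measurableT_comp mf mZ).
  exists (`|f z| + e); split; first by rewrite num_real.
  move=> x xM w /= Uw; rewrite (le_trans _ (ltW xM))//.
  rewrite -lerBlDl (le_trans (lerB_dist _ _))// distrC; apply: ltW; exact: fB.
have cst_int (a : R) : (\int[Q]_(w in Z @^-1` U) a%:E = a%:E * Q (Z @^-1` U))%E.
  by rewrite integral_cst.
have := Qg _ mU; rewrite (Qh _ mU) => gh_eq.
have : ((h z - e)%:E * Q (Z @^-1` U) <= (g z + e)%:E * Q (Z @^-1` U))%E.
  rewrite -!cst_int.
  apply: le_trans
    (_ : _ <= \int[Q]_(w in Z @^-1` U) (h (row_of_tuple (Z w)))%:E)%E _.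
    apply: le_integral => //.
    - by apply/integrableP; split => //; rewrite integral_cst// lte_mul_pinfty// lee_fin.
    - by apply: intf => // t /UB[].
    - move=> w; rewrite inE => /UB[_]; rewrite lee_fin ltr_norml => /andP[_ ?]; lra.
  rewrite gh_eq; apply: le_integral => //.
  - by apply: intf => // t /UB[].
  - by apply/integrableP; split => //; rewrite integral_cst// lte_mul_pinfty// lee_fin.
  - move=> w; rewrite inE => /UB[+ _]; rewrite lee_fin ltr_norml => /andP[? _]; lra.
have -> : Q (Z @^-1` U) = (fine (Q (Z @^-1` U)))%:E by rewrite fineK// fin_num_measure.
rewrite -!EFinM lee_fin ler_pM2r; last by rewrite fine_gt0// QU0.
by rewrite leNgt => /negP; apply; rewrite /e; lra.
Unshelve. all: by end_near. Qed.

Lemma cond_prob_unique (g h : 'rV[R]_n -> R) :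
  continuous g -> is_cond_prob Q Z E g -> continuous h -> is_cond_prob Q Z E h ->
  g = h.
Proof.
move=> cg Qg ch Qh; apply/funext => z; apply: le_anti.
by rewrite !cond_prob_not_lt.
Qed.

End CondProbUnique.

(** * Triangular structural equations *)

Section TriangularSystem.
Context (R : realType) (m : nat) (l : 'I_m -> 'I_m -> R).
Hypothesis ltri : forall i j : 'I_m, (i <= j)%N -> l i j = 0.

(** Forward substitution; c is the matrix (1 - l)^-1.  It is obtained once for
    all right-hand sides e, so that it serves both the noise itself and the noise
    shifted by a deterministic vector. *)
Lemma triangular_inverse : exists c : 'I_m -> 'I_m -> R,
  (forall k j : 'I_m, (k < j)%N -> c k j = 0) /\
  forall y e : 'I_m -> R, (forall k, y k = \sum_j l k j * y j + e k) ->
    forall k, y k = \sum_j c k j * e j.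
Proof.
pose good (k : 'I_m) (ck : 'I_m -> R) := (forall j : 'I_m, (k < j)%N -> ck j = 0) /\
  forall y e : 'I_m -> R, (forall k, y k = \sum_j l k j * y j + e k) ->
    y k = \sum_j ck j * e j.
suff /choice[c hc] : forall k : 'I_m, exists ck, good k ck.
  exists c; split=> [k|y e sys k]; first by case: (hc k).
  by have [_ /(_ _ _ sys)] := hc k.
suff H n (k : 'I_m) : (k < n)%N -> exists ck, good k ck by move=> k; exact: (H k.+1).
elim: n k => // n IH k; rewrite ltnS leq_eqVlt => /orP[/eqP kn|]; last exact: IH.
have /choice[c hc] : forall i : 'I_m, exists ci, (i < k)%N -> good i ci.
  move=> i; have [ik|] := boolP (i < k)%N; last by exists (fun=> 0).
  by have [|ci hci] := IH i; [rewrite -kn|exists ci].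
exists (fun j => \sum_i l k i * c i j + (j == k)%:R); split.
  move=> j kj; rewrite big1 => [|i _].
    by rewrite add0r -val_eqE/= gtn_eqF.
  have [ki|ik] := leqP k i; first by rewrite ltri// mul0r.
  by have [-> //] := hc i ik; [rewrite mulr0|exact: ltn_trans kj].
move=> y e sys; rewrite sys.
under [RHS]eq_bigr do rewrite mulrDl.
rewrite big_split/=; congr (_ + _); last first.
  rewrite (bigD1 k)//= eqxx mul1r big1 ?addr0// => j jk.
  by rewrite (negbTE jk) mul0r.
under [RHS]eq_bigr do rewrite mulr_suml.
rewrite exchange_big/=; apply: eq_bigr => i _.
have [ki|ik] := leqP k i.
  by rewrite ltri// mul0r big1// => j _; rewrite !mul0r.
have [_ /(_ _ _ sys) ->] := hc i ik.
by rewrite mulr_sumr; apply: eq_bigr => j _; rewrite mulrA.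
Qed.

Lemma sum_predecessors (i : 'I_m) (F : 'I_m -> R) :
  (forall j : 'I_m, (i <= j)%N -> F j = 0) ->
  \sum_j F j = \sum_(j < i) F (widen_ord (ltnW (ltn_ord i)) j).
Proof.
move=> F0; rewrite -(big_ord_narrow (F := F)) [RHS]big_mkcond/=.
by apply: eq_bigr => j _; case: ltnP => // /F0.
Qed.

End TriangularSystem.

Lemma measurable_near_box d (T : measurableType d) (R : realType) (n : nat)
    (f : 'I_n -> T -> R) (a : 'I_n -> R) (r : R) :
  (forall j, measurable_fun setT (f j)) ->
  measurable [set w | forall j, `|a j - f j w| < r].
Proof.
move=> mf.
rewrite (_ : [set _ | _] = \bigcap_(k in [set: 'I_n]) (f k @^-1` ball (a k) r)).
  apply: fin_bigcap_measurable => // k _.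
  by apply: measurable_preimageT => //; exact: measurable_ball.
by apply/seteqP; split=> [w h k _|w h k]; apply: h.
Qed.

Section Model.
Context d (T : measurableType d) (R : realType) (Q : probability T R).
Context (m : nat) (Y E : 'I_m -> T -> R) (l : 'I_m -> 'I_m -> R) (s : 'I_m -> R).
Hypothesis mE : forall i, measurable_fun setT (E i).
Hypothesis mY : forall i, measurable_fun setT (Y i).
Hypothesis indepE : forall (J : {set 'I_m}) (B : 'I_m -> set R),
  (forall i, measurable (B i)) ->
  Q (\bigcap_(i in [set` J]) (E i @^-1` B i)) = (\prod_(i in J) Q (E i @^-1` B i))%E.
Hypothesis gaussE : forall i, has_gauss1 Q (E i) 0 (s i).
Hypothesis s0 : forall i, s i != 0.
Hypothesis ltri : forall i j : 'I_m, (i <= j)%N -> l i j = 0.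
Hypothesis sys : forall i w, Y i w = \sum_j l i j * Y j w + E i w.

(** Y - z solves the triangular system with right-hand side E - e, where e is the
    noise that produces z.  So Y is close to z as soon as every E_k is close to
    e_k; these are independent events of positive probability. *)
Lemma full_support (z : 'I_m -> R) (r : R) : 0 < r ->
  (0 < Q [set w | forall k, (`|z k - Y k w| < r)%R])%E.
Proof.
move=> r0; have [c [_ hc]] := triangular_inverse ltri.
pose e k := z k - \sum_j l k j * z j.
(* C exceeds the absolute row sums of c, so noise within r / C of e keeps Y
   within r of z. *)
pose C := 1 + \sum_k \sum_j `|c k j|.
have C0 : 0 < C by rewrite ltr_pwDl// sumr_ge0// => k _; rewrite sumr_ge0.
have rC0 : 0 < r / C by rewrite divr_gt0.
pose B k := [set x : R | `|e k - x| < r / C].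
have BE k : B k = `]e k - r / C, e k + r / C[%classic.
  by rewrite -ball_itv.
have mB k : measurable (B k) by rewrite BE.
have mbox : measurable (\bigcap_(k in [set` [set: 'I_m]%SET]) (E k @^-1` B k)).
  by apply: fin_bigcap_measurable => // k _; exact: measurable_preimageT.
apply: (@lt_le_trans _ _ (Q (\bigcap_(k in [set` [set: 'I_m]%SET]) (E k @^-1` B k)))).
  rewrite indepE//; apply: (big_ind (fun x : \bar R => 0 < x)%E) => //.
    by move=> x y; exact: mule_gt0.
  move=> k _; rewrite gaussE// /gauss1 (negbTE (s0 k)) BE.
  by apply: normal_prob_ooitv_gt0 => //; lra.
apply: le_measure; rewrite ?inE//; first exact: measurable_near_box.
move=> w Bw k /=.
have -> : z k - Y k w = \sum_j c k j * (e j - E j w).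
  apply: (hc (fun k => z k - Y k w)) => {}k /=.
  rewrite [in LHS]sys /e; under [in RHS]eq_bigr do rewrite mulrBr.
  by rewrite sumrB; ring.
apply: (@le_lt_trans _ _ (\sum_j `|c k j| * (r / C))).
  rewrite (le_trans (ler_norm_sum _ _ _))// ler_sum// => j _.
  rewrite normrM ler_wpM2l// ltW//; apply: Bw; rewrite /= inE.
  by [].
rewrite -mulr_suml mulrCA gtr_pMr// ltr_pdivrMr// mul1r.
rewrite /C [in ltRHS](bigD1 k)//= addrCA ltrDl ltr_pwDl// sumr_ge0// => i _.
by rewrite sumr_ge0.
Qed.

Definition regression (i : 'I_m) (y : 'rV[R]_i) : R :=
  \sum_j l i (widen_ord (ltnW (ltn_ord i)) j) * y 0 j.

Lemma regressionE i w :
  Y i w = regression (row_of_tuple (predecessors Y i w)) + E i w.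
Proof.
rewrite sys (sum_predecessors (i := i)); last by move=> j ij; rewrite ltri// mul0r.
by congr (_ + _); apply: eq_bigr => j _; rewrite mxE tnth_mktuple.
Qed.

Lemma continuous_regression i : continuous (@regression i).
Proof.
apply: (@continuous_big R _ +%R 0 xpredT (@add_continuous R^o)) => j _ y.
by apply: continuousM; [exact: cst_continuous|exact: coord_continuous].
Qed.

Lemma measurable_regression (i : 'I_m) :
  measurable_fun setT (fun t : i.-tuple R => regression (row_of_tuple t)).
Proof.
apply: measurable_sum => j; apply: measurable_funM => //.
under eq_fun do rewrite mxE.
exact: measurable_tnth.
Qed.

(** The predecessors of Y_i are a measurable function of those of E_i, because
    the inverse of a triangular system is triangular. *)
Lemma predecessors_noise_independent (i : 'I_m) (A : set (i.-tuple R)) (B : set R) :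
  measurable A -> measurable B ->
  Q (predecessors Y i @^-1` A `&` E i @^-1` B) =
  (Q (predecessors Y i @^-1` A) * Q (E i @^-1` B))%E.
Proof.
move=> mA mB; have [c [ctri hc]] := triangular_inverse ltri.
pose w_ := widen_ord (ltnW (ltn_ord i)).
pose Phi (f : i.-tuple R) : i.-tuple R :=
  [tuple \sum_(k < i) c (w_ j) (w_ k) * tnth f k | j < i].
have mPhi : measurable_fun setT Phi.
  apply/measurable_fun_tnthP => j.
  rewrite (_ : _ \o _ = fun f => \sum_(k < i) c (w_ j) (w_ k) * tnth f k); last first.
    by apply/funext => f /=; rewrite tnth_mktuple.
  by apply: measurable_sum => k; apply: measurable_funM => //; exact: measurable_tnth.
have YE : predecessors Y i = Phi \o predecessors E i.
  apply/funext => w; apply: eq_from_tnth => j; rewrite /= !tnth_mktuple.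
  rewrite (hc (Y^~ w) (E^~ w)) => [|k]; last exact: sys.
  rewrite (sum_predecessors (i := i)) => [|k ik]; last first.
    by rewrite ctri ?mul0r//; apply: leq_trans ik => /=.
  by apply: eq_bigr => k _; rewrite tnth_mktuple.
rewrite YE comp_preimage; apply: predecessors_independent => //.
exact: measurable_preimageT.
Qed.

Definition normal_cond_prob (i : 'I_m) (t : R) (y : 'rV[R]_i) : R :=
  normal_tail (s i) (t - regression y).

Lemma continuous_normal_cond_prob i t : continuous (@normal_cond_prob i t).
Proof.
move=> y; apply: (@continuous_comp _ _ _ (fun y => t - regression y) (normal_tail (s i))).
  by apply: continuousB; [exact: cst_continuous|exact: continuous_regression].
exact: continuous_normal_tail.
Qed.

(** Since Y_i = regression (past) + E_i with E_i independent of the past, the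
    joint law of the past and E_i is a product measure, and integrating out E_i
    first leaves the normal tail at t - regression. *)
Lemma normal_cond_probP i t :
  is_cond_prob Q (predecessors Y i) [set w | t <= Y i w] (@normal_cond_prob i t).
Proof.
have mh : measurable_fun setT (fun u : i.-tuple R => normal_cond_prob t (row_of_tuple u)).
  apply: (measurableT_comp (f := normal_tail (s i))).
    by apply: continuous_measurable_fun; exact: continuous_normal_tail.
  by apply: measurable_funB => //; exact: measurable_regression.
split=> // A mA.
have mZ : measurable_fun setT (predecessors Y i) by exact: measurable_predecessors.
pose Z : {mfun T >-> i.-tuple R} :=
  HB.pack (predecessors Y i) (isMeasurableFun.Build _ _ _ _ _ mZ).
pose N : {mfun T >-> R} := HB.pack (E i) (isMeasurableFun.Build _ _ _ _ _ (mE i)).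
have mZN : measurable_fun setT (fun w => (predecessors Y i w, E i w)).
  exact: measurable_fun_pair.
pose J : {mfun T >-> (i.-tuple R * R)%type} :=
  HB.pack (fun w => (predecessors Y i w, E i w)) (isMeasurableFun.Build _ _ _ _ _ mZN).
pose X := [set p : i.-tuple R * R | A p.1 /\ t <= regression (row_of_tuple p.1) + p.2].
have mX : measurable X.
  rewrite (_ : X = fst @^-1` A `&`
      (fun p => regression (row_of_tuple p.1) + p.2) @^-1` `[t, +oo[); last first.
    by apply/seteqP; split=> p /=; rewrite in_itv/= andbT.
  apply: measurableI; first exact: measurable_preimageT.
  apply: measurable_preimageT => //; apply: measurable_funD => //.
  exact: (measurableT_comp (@measurable_regression i) measurable_fst).
have prodE := @product_measure_unique _ _ _ _ R (distribution Q Z) (distribution Q N)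
  (distribution Q J) (predecessors_noise_independent (i := i)) X mX.
have -> : predecessors Y i @^-1` A `&` [set w | t <= Y i w] = J @^-1` X.
  by apply/seteqP; split=> w /=; rewrite regressionE.
rewrite -[LHS]prodE /product_measure1.
pose h (u : i.-tuple R) := (normal_cond_prob t (row_of_tuple u))%:E.
have -> : (\int[distribution Q Z]_u (distribution Q N \o xsection X) u =
    \int[distribution Q Z]_(u in A) h u)%E.
  rewrite [RHS]integral_mkcond; apply: eq_integral => u _.
  rewrite /= /distribution /pushforward/= patchE.
  have [uA|uA] := boolP (u \in A).
    rewrite (_ : xsection X u =
      `[t - regression (row_of_tuple u), +oo[%classic); last first.
      apply/seteqP; split=> x; rewrite /xsection/= inE in_itv/= andbT lerBlDl.
        by case.
      by split => //; rewrite inE in uA.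
    by rewrite gaussE// /gauss1 (negbTE (s0 i)) normal_tailE.
  rewrite (_ : xsection X u = set0) ?preimage_set0 ?measure0//.
  apply/seteqP; split=> // x; rewrite /xsection/= inE => -[uA' _].
  by move: uA; rewrite notin_setE.
rewrite ge0_integral_pushforward//.
- by apply/measurable_funTS/measurable_EFinP.
- by move=> u _; rewrite lee_fin normal_tail_ge0.
Qed.

Lemma supp_predecessors (i : 'I_m) (z : 'rV[R]_i) (r : R) : 0 < r ->
  (0 < Q [set w | forall j, (`|z 0%R j - tnth (predecessors Y i w) j| < r)%R])%E.
Proof.
move=> r0; pose w_ := widen_ord (ltnW (ltn_ord i)).
pose z' (k : 'I_m) := if (insub (k : nat) : option 'I_i) is Some j then z 0 j else 0.
apply: lt_le_trans (full_support z' r0) _.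
apply: le_measure; rewrite ?inE; [exact: measurable_near_box| |].
  apply: (measurable_near_box (f := fun j w => tnth (predecessors Y i w) j)) => j.
  rewrite (_ : (fun w => _) = Y (w_ j))//.
  by apply/funext => w; rewrite tnth_mktuple.
move=> w h j /=; rewrite tnth_mktuple; have := h (w_ j).
rewrite /z'; case: insubP => [j' _ /= jj'|/negP[]//=].
by rewrite (_ : j' = j)//; apply/val_inj.
Qed.

(** By uniqueness, the version in the definition of CIS must be the explicit
    normal tail, which is monotone in the past exactly when the regression
    coefficients are nonnegative: compare the past 0 with a unit vector. *)
Lemma CIS_iff_nonneg : CIS Q Y <-> forall i j, 0 <= l i j.
Proof.
split=> [cis i j|l0 i t].
  have [ij|ji] := leqP i j; first by rewrite ltri.
  have [g [cg Qg gmono]] := cis i 0.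
  have gE : g = @normal_cond_prob i 0.
    apply: (cond_prob_unique (measurable_predecessors mY) (@supp_predecessors i)) => //.
    - exact: Qg.
    - exact: continuous_normal_cond_prob.
    - exact: normal_cond_probP.
  rewrite leNgt; apply/negP => lneg; pose j' := Ordinal ji.
  have reg0 : regression (0 : 'rV[R]_i) = 0.
    by rewrite /regression big1// => k _; rewrite mxE mulr0.
  have regj : regression (delta_mx 0 j' : 'rV[R]_i) = l i j.
    rewrite /regression (bigD1 j')//= big1 ?addr0 => [|k kj].
      by rewrite mxE !eqxx mulr1; congr (l i _); apply/val_inj.
    by rewrite mxE (negbTE kj) andbF mulr0.
  have : g 0 <= g (delta_mx 0 j').
    apply: (gmono j') => [k kj|]; first by rewrite !mxE (negbTE kj) andbF.
    by rewrite !mxE !eqxx ler01.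
  rewrite gE /normal_cond_prob reg0 regj !sub0r oppr0.
  by rewrite leNgt normal_tail_decr// oppr_gt0.
exists (@normal_cond_prob i t); split.
- exact: continuous_normal_cond_prob.
- exact: normal_cond_probP.
- move=> j y y' yy' yj.
  have : regression y <= regression y'.
    apply: ler_sum => k _; rewrite ler_wpM2l//.
    by have [->//|kj] := eqVneq k j; rewrite yy'.
  rewrite le_eqVlt => /orP[/eqP yE|ylt]; first by rewrite /normal_cond_prob yE.
  by apply/ltW/normal_tail_decr => //; rewrite ltrD2l ltrN2.
Qed.

End Model.

(** * Residuals of a representation, and the theorem *)

Section Residuals.
Context (R : realType) (m : nat) (G : rel 'I_m) (L : 'M[R]_m).

Definition residual (i : 'I_m) (x : m.-tuple R) : R :=
  coordinate i x - \sum_(j | G j i) L i j * coordinate j x.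

Lemma measurable_residual i : measurable_fun setT (residual i).
Proof.
apply: measurable_funB; first exact: measurable_coordinate.
rewrite (_ : (fun x => _) =
  fun x : m.-tuple R => \sum_j (if G j i then L i j * coordinate j x else 0)); last first.
  by apply/funext => x; rewrite big_mkcond.
apply: measurable_sum => j; case: (G j i) => //.
by apply: measurable_funM => //; exact: measurable_coordinate.
Qed.

Variable P : probability (m.-tuple R) R.
Hypothesis rep : has_representation G L P.

(** On the space of a representation the residuals are exactly the noise
    variables, and their joint law is determined by the law P.  So the noise
    may be taken to live on R^m itself, next to the coordinates. *)
Lemma residual_law : exists s : 'I_m -> R,
  (forall i, has_gauss1 P (residual i) 0 (s i)) /\
  forall (J : {set 'I_m}) (B : 'I_m -> set R), (forall i, measurable (B i)) ->
    P (\bigcap_(i in [set` J]) (residual i @^-1` B i)) =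
    (\prod_(i in J) P (residual i @^-1` B i))%E.
Proof.
have [d [T [Q [X [eps [s [lawX indep gauss sys]]]]]]] := rep.
have resE w i : residual i [tuple X i w | i < m] = eps i w.
  rewrite /residual /coordinate tnth_mktuple sys addrAC.
  under [X in _ - X]eq_bigr do rewrite tnth_mktuple.
  by rewrite subrr add0r.
have mr i B : measurable B -> measurable (residual i @^-1` B).
  by apply: measurable_preimageT; exact: measurable_residual.
have lawE i B : measurable B -> Q (eps i @^-1` B) = P (residual i @^-1` B).
  move=> mB; rewrite -lawX; last exact: mr.
  by congr (Q _); apply/seteqP; split=> w; rewrite /= resE.
exists s; split=> [i B mB|J B mB]; first by rewrite -gauss// lawE.
rewrite -lawX; last by apply: fin_bigcap_measurable => // i _; exact: mr.
have -> : (fun w => [tuple X i w | i < m]) @^-1`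
    (\bigcap_(i in [set` J]) (residual i @^-1` B i)) =
    \bigcap_(i in [set` J]) (eps i @^-1` B i).
  by apply/seteqP; split=> w h i iJ; have := h i iJ; rewrite /= resE.
by rewrite indep//; apply: eq_bigr => i _; rewrite lawE.
Qed.

(** Without a loop at i, the residual is a linear form with coefficient 1 at i. *)
Lemma residual_nondegenerate i : gaussian P -> ~~ G i i ->
  P (residual i @^-1` [set 0]) != 1%E.
Proof.
move=> gP Gii.
pose u : 'rV[R]_m := \row_j ((j == i)%:R - (if G j i then L i j else 0)).
have u0 : u != 0.
  apply/eqP => /rowP/(_ i); rewrite !mxE eqxx (negbTE Gii) subr0.
  by apply/eqP; rewrite oner_eq0.
have := gaussian_nondegenerate gP u0.
rewrite (_ : (fun x => _) = residual i)//; apply/funext => x.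
under eq_bigr do rewrite mxE mulrBl.
rewrite sumrB (bigD1 i)//= eqxx mul1r big1 ?addr0 => [|j /negbTE ->]; last first.
  by rewrite mul0r.
rewrite /residual [in RHS]big_mkcond; congr (_ - _); apply: eq_bigr => j _.
by case: ifP => // _; rewrite mul0r.
Qed.

End Residuals.

(** Listing the vertices along sigma makes the structural equations strictly
    lower triangular, with the residuals as noise; nondegeneracy of the residuals
    gives nonzero noise variances. *)
Lemma representation_CIS_iff (R : realType) (m : nat) (G : rel 'I_m)
    (sigma : {perm 'I_m}) (L : 'M[R]_m) (P : probability (m.-tuple R) R) :
  topological_ordering G sigma -> gaussian P -> has_representation G L P ->
  CIS P (fun i => @coordinate R m (sigma i)) <-> (forall i j, G j i -> 0 <= L i j).
Proof.
move=> top gP rep.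
have irrG i : ~~ G i i by apply/negP => /top; rewrite ltnn.
have [s [gauss indep_res]] := residual_law rep.
have s0 i : s i != 0.
  apply/eqP => si; have := residual_nondegenerate L gP (irrG i).
  rewrite (gauss i)// /gauss1 si eqxx.
  by rewrite diracE mem_set// eqxx.
pose l (k j : 'I_m) := if G (sigma j) (sigma k) then L (sigma k) (sigma j) else 0.
have ltri (i j : 'I_m) : (i <= j)%N -> l i j = 0.
  by move=> ij; rewrite /l; case: ifP => // /top; rewrite !permK ltnNge ij.
have indep (J : {set 'I_m}) (B : 'I_m -> set R) : (forall i, measurable (B i)) ->
  P (\bigcap_(i in [set` J]) (residual G L (sigma i) @^-1` B i)) =
  (\prod_(i in J) P (residual G L (sigma i) @^-1` B i))%E.
  move=> mB; pose B' i := B ((sigma^-1)%g i).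
  have := indep_res (sigma @: J)%SET B' (fun i => mB _).
  rewrite big_imset/=; last by move=> i j _ _; exact: perm_inj.
  under eq_bigr do rewrite /B' permK.
  move=> <-; congr (P _); apply/seteqP; split=> [w h _ /imsetP[i iJ ->]|w h i iJ].
    by rewrite /= /B' permK; exact: h.
  by have := h (sigma i) (imset_f _ iJ); rewrite /= /B' permK.
have sys i w : coordinate (sigma i) w =
    \sum_j l i j * coordinate (sigma j) w + residual G L (sigma i) w.
  suff -> : \sum_j l i j * coordinate (sigma j) w =
      \sum_(j | G j (sigma i)) L (sigma i) j * coordinate j w.
    by rewrite addrC subrK.
  rewrite [RHS]big_mkcond [RHS](reindex_inj (@perm_inj _ sigma)) /=.
  by apply: eq_bigr => j _; rewrite /l; case: ifP => // _; rewrite mul0r.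
have -> : CIS P (fun i => @coordinate R m (sigma i)) <-> forall i j, 0 <= l i j.
  apply: (CIS_iff_nonneg (E := fun i => residual G L (sigma i)) (s := s \o sigma)) => //.
  - by move=> i; exact: measurable_residual.
  - by move=> i; exact: measurable_coordinate.
  - by move=> i; exact: s0.
split=> [l0 i j Gji|L0 i j].
  by have := l0 ((sigma^-1)%g i) ((sigma^-1)%g j); rewrite /l !permKV Gji.
by rewrite /l; case: ifP => // /L0.
Qed.

Theorem theorem2p5 (R : realType) (m : nat) (G : rel 'I_m) (sigma : {perm 'I_m})
  (hG : acyclic G) (hsigma : topological_ordering G sigma) :
  @MM_plus R m G = @MM R m G `&` @CIS_ordered R m sigma.
Proof.
apply/seteqP; split=> P.
  move=> [gP [L [L0 rep]]]; split; first by split => //; exists L.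
  by split => //; apply/(representation_CIS_iff hsigma gP rep).
move=> [[gP [L rep]] [_ cis]]; split => //; exists L; split => //.
exact/(representation_CIS_iff hsigma gP rep).
Qed.
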